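(* Let $\mathbb{F}$ be a field of characteristic zero, let $n\geq 3$ and $\alpha\in\mathbb{F}^*$. Let $\mathfrak{sl}_n$ be the Lie algebra of traceless $n\times n$ matrices over $\mathbb{F}$, with basis consisting of the matrix units $E_{ij}$ ($1\leq i\neq j\leq n$) and $h_i=E_{ii}-E_{i+1,i+1}$ ($1\leq i\leq n-1$). Define a linear map $\Delta_\alpha:\mathfrak{sl}_n\to\mathfrak{sl}_n$ by setting $$\Delta_\alpha(E_{1,n-1})=E_{n1}+\alpha E_{n,n-1},\quad \Delta_\alpha(E_{1n})=E_{1,n-1},\quad \Delta_\alpha(E_{n1})=E_{n,n-1},\quad \Delta_\alpha(E_{n,n-1})=E_{1n},$$ and letting $\Delta_\alpha$ fix all the other basis elements. Then $\Delta_\alpha$ agrees with automorphisms on each basis element (that is, for each element $b$ of the basis $\{E_{ij}\mid 1\leq i\neq j\leq n\}\cup\{h_i\mid 1\leq i\leq n-1\}$ of $\mathfrak{sl}_n$ there is an automorphism $\varphi_b$ of $\mathfrak{sl}_n$ with $\Delta_\alpha(b)=\varphi_b(b)$), but $\Delta_\alpha$ is not a local automorphism of $\mathfrak{sl}_n$.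
   Context: $E_{ij}$ denotes the $n\times n$ matrix with entry $1$ in position $(i,j)$ and zeros elsewhere. The Lie bracket on $\mathfrak{sl}_n$ is the commutator $[a,b]=ab-ba$. An automorphism of a Lie algebra $\mathfrak{g}$ is a linear bijective map $\varphi:\mathfrak{g}\to\mathfrak{g}$ with $\varphi([x,y])=[\varphi(x),\varphi(y)]$ for all $x,y\in\mathfrak{g}$. A linear map $\Delta:\mathfrak{g}\to\mathfrak{g}$ is a local automorphism if for every $X\in\mathfrak{g}$ there exists an automorphism $\varphi_X$ of $\mathfrak{g}$ (depending on $X$) with $\Delta(X)=\varphi_X(X)$. *)

(* Defs.v *)
From HB Require Import structures.
From mathcomp Require Import all_boot all_order all_algebra.
From mathcomp Require Import ring.

Set Implicit Arguments.
Unset Strict Implicit.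
Unset Printing Implicit Defensive.

Import GRing.Theory.
Local Open Scope ring_scope.

HB.mixin Record Lmodule_isLieAlgebra (R : pzRingType) (V : Type)
    of GRing.Lmodule R V := {
  lie : V -> V -> V;
  lie_linearl : forall y : V, linear (fun x : V => lie x y);
  lie_linearr : forall x : V, linear (lie x);
  liexx : forall x : V, lie x x = 0;
  lie_jacobi : forall x y z : V,
    lie x (lie y z) + lie y (lie z x) + lie z (lie x y) = 0
}.

#[short(type="lieAlgType")]
HB.structure Definition LieAlgebra (R : pzRingType) :=
  {V of Lmodule_isLieAlgebra R V & GRing.Lmodule R V}.

Definition lie_automorphism (R : pzRingType) (g : lieAlgType R)
    (phi : {linear g -> g}) : Prop :=
  bijective phi /\ forall x y : g, phi (lie x y) = lie (phi x) (phi y).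

Definition local_automorphism (R : pzRingType) (g : lieAlgType R)
    (Delta : {linear g -> g}) : Prop :=
  forall X : g, exists phi : {linear g -> g},
    lie_automorphism phi /\ Delta X = phi X.

Section SpecialLinear.
Variables (F : fieldType) (n : nat).

Definition traceless : {pred 'M[F]_n} := fun A => \tr A == 0.

Lemma traceless_submod_closed : submod_closed traceless.
Proof.
split=> [|a A B]; first by rewrite /in_mem /= /traceless mxtrace0.
rewrite /in_mem /= /traceless => /eqP trA /eqP trB.
by rewrite mxtraceD mxtraceZ trA trB mulr0 addr0.
Qed.

HB.instance Definition _ :=
  GRing.isSubmodClosed.Build F 'M[F]_n traceless traceless_submod_closed.

Record sl := Sl { slval :> 'M[F]_n; _ : slval \in traceless }.

HB.instance Definition _ := [isSub for slval].
HB.instance Definition _ := [Choice of sl by <:].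
HB.instance Definition _ := [SubChoice_isSubLmodule of sl by <:].

Lemma mxtrace_sl (x : sl) : \tr x = 0.
Proof. by case: x => A /= /eqP. Qed.

Lemma commutator_traceless (A B : 'M[F]_n) :
  A *m B - B *m A \in traceless.
Proof. by rewrite /in_mem /= /traceless linearB /= mxtrace_mulC subrr. Qed.

Definition sl_lie (x y : sl) : sl := Sl (commutator_traceless x y).

Lemma sl_lie_linearl (y : sl) : linear (fun x => sl_lie x y).
Proof.
move=> a x z; apply: val_inj => /=.
rewrite mulmxDl mulmxDr -scalemxAl -scalemxAr scalerBr opprD.
by rewrite !addrA; congr (_ + _); rewrite addrAC.
Qed.

Lemma sl_lie_linearr (x : sl) : linear (sl_lie x).
Proof.
move=> a y z; apply: val_inj => /=.
rewrite mulmxDl mulmxDr -scalemxAl -scalemxAr scalerBr opprD.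
by rewrite !addrA; congr (_ + _); rewrite addrAC.
Qed.

Lemma sl_liexx (x : sl) : sl_lie x x = 0.
Proof. by apply: val_inj; rewrite /= subrr. Qed.

Lemma sl_lie_jacobi (x y z : sl) :
  sl_lie x (sl_lie y z) + sl_lie y (sl_lie z x) + sl_lie z (sl_lie x y) = 0.
Proof.
apply: val_inj => /=.
case: x y z => [A _] [B _] [C _] /=.
rewrite !(mulmxBl, mulmxBr) !mulmxA.
move: (A *m B *m C) (A *m C *m B) (B *m A *m C) => ABC ACB BAC.
move: (B *m C *m A) (C *m A *m B) (C *m B *m A) => BCA CAB CBA.
by apply/matrixP=> i j; rewrite !mxE; ring.
Qed.

HB.instance Definition _ :=
  Lmodule_isLieAlgebra.Build F sl
    sl_lie_linearl sl_lie_linearr sl_liexx sl_lie_jacobi.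

(* The basis {E_ij | i <> j} u {E_ii - E_{i+1,i+1}} of sl_n. *)
Definition sl_basis (b : sl) : Prop :=
  (exists i j : 'I_n, i != j /\ val b = delta_mx i j)
  \/ (exists i j : 'I_n,
        j = i.+1 :> nat /\ val b = delta_mx i i - delta_mx j j).

Lemma sl_basis_ind (P : sl -> Prop) :
  (forall (a : F) x y, P x -> P y -> P (a *: x + y)) -> P 0 ->
  (forall b, sl_basis b -> P b) -> forall x, P x.
Proof.
move=> PD P0 Pb x.
have Padd y z : P y -> P z -> P (y + z).
  by move=> Py Pz; rewrite -[y]scale1r; apply: PD.
have Pscale a y : P y -> P (a *: y).
  by move=> Py; rewrite -[_ *: _]addr0; apply: PD.
have Psum I (r : seq I) (Q : pred I) (G : I -> sl) :
    (forall i, Q i -> P (G i)) -> P (\sum_(i <- r | Q i) G i).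
  by move=> PG; elim/big_ind: _.
have valD (y z : sl) : val (y + z) = val y + val z by [].
have valZ a (y : sl) : val (a *: y) = a *: val y by [].
have valS I (r : seq I) (Q : pred I) (G : I -> sl) :
    val (\sum_(i <- r | Q i) G i) = \sum_(i <- r | Q i) val (G i).
  exact: raddf_sum.
pose mk (A : 'M[F]_n) : sl := insubd (0 : sl) A.
have mkK A : \tr A = 0 -> val (mk A) = A.
  by move=> trA; rewrite insubdK // /in_mem /= /traceless trA.
have trD (i j : 'I_n) : \tr (delta_mx i j : 'M[F]_n) = (i == j)%:R.
  rewrite /mxtrace (bigD1 i) //= mxE eqxx /= big1 ?addr0 // => k ki.
  by rewrite mxE (negPf ki).
have Poff (i j : 'I_n) : i != j -> P (mk (delta_mx i j)).
  move=> ij; apply: Pb; left; exists i, j; split=> //.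
  by rewrite mkK // trD (negPf ij).
have trd (i j : 'I_n) : \tr (delta_mx i i - delta_mx j j : 'M[F]_n) = 0.
  by rewrite linearB /= !trD !eqxx subrr.
have Pdiag (i j : 'I_n) : (i <= j)%N ->
    P (mk (delta_mx i i - delta_mx j j)).
  move eqk : (j - i)%N => k; elim: k j eqk => [|k IH] j eqk le_ij.
    have -> : j = i by apply/val_inj/eqP; rewrite eqn_leq le_ij -subn_eq0 eqk.
    suff -> : mk (delta_mx i i - delta_mx i i) = 0 by [].
    by apply: val_inj; rewrite mkK ?trd // subrr.
  have lt_ij : (i < j)%N by rewrite -subn_gt0 eqk.
  have lt_j' : (j.-1 < n)%N by apply: leq_ltn_trans (leq_pred _) (ltn_ord j).
  pose j' := Ordinal lt_j'.
  have j'S : j = j'.+1 :> nat by rewrite /= prednK // (leq_ltn_trans _ lt_ij).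
  have -> : mk (delta_mx i i - delta_mx j j) =
      mk (delta_mx i i - delta_mx j' j') + mk (delta_mx j' j' - delta_mx j j).
    by apply: val_inj; rewrite raddfD /= !mkK ?trd // addrA subrK.
  apply: Padd; last first.
    by apply: Pb; right; exists j', j; split=> //; rewrite mkK ?trd.
  apply: IH; last by rewrite -ltnS -j'S.
  by move: eqk; rewrite j'S subSn ?(inj_eq succn_inj) => [[]|] //; rewrite -ltnS -j'S.
case: (posnP n) => [n0|n_gt0].
  suff -> : x = 0 by [].
  by apply/val_inj/matrixP => i; have := ltn_ord i; rewrite {2}n0.
pose i0 := Ordinal n_gt0.
have Pd (i : 'I_n) : P (mk (delta_mx i i - delta_mx i0 i0)).
  have -> : mk (delta_mx i i - delta_mx i0 i0) =
      (-1) *: mk (delta_mx i0 i0 - delta_mx i i).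
    by apply: val_inj; rewrite linearZ /= !mkK ?trd // scaleN1r opprB.
  by apply/Pscale/Pdiag.
suff -> : x = \sum_i \sum_(j | i != j) x i j *: mk (delta_mx i j)
            + \sum_i x i i *: mk (delta_mx i i - delta_mx i0 i0).
  apply: Padd; apply: (Psum) => i _; last exact: Pscale.
  by apply: Psum => j ij; apply/Pscale/Poff.
apply: val_inj; rewrite valD !valS.
under eq_bigr do rewrite valS.
under [X in _ = _ + X]eq_bigr do rewrite valZ mkK ?trd // scalerBr.
rewrite [X in _ = _ + X]big_split /= sumrN -scaler_suml.
rewrite -[\sum_i x i i]/(\tr x) mxtrace_sl scale0r subr0 -big_split /=.
rewrite {1}[slval x]matrix_sum_delta; apply: eq_bigr => i _.
rewrite (bigD1 i) //= addrC; congr (_ + _).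
rewrite (eq_bigl (fun j => i != j)) => [|j]; last by rewrite eq_sym.
apply: eq_bigr => j ij.
transitivity (x i j *: val (mk (delta_mx i j))); last by [].
by rewrite mkK // trD (negPf ij).
Qed.

Section Delta.
Hypothesis n_ge3 : (3 <= n)%N.

(* 0-based ordinals for the 1-based indices 1, n-1 and n. *)
Lemma ix1_subproof : (0 < n)%N. Proof. by case: n n_ge3. Qed.
Lemma ixp_subproof : (n - 2 < n)%N.
Proof. by case: n n_ge3 => // k _; rewrite ltn_subrL. Qed.
Lemma ixn_subproof : (n - 1 < n)%N.
Proof. by case: n n_ge3 => // k _; rewrite ltn_subrL. Qed.

Definition ix1 : 'I_n := Ordinal ix1_subproof.
Definition ixp : 'I_n := Ordinal ixp_subproof.
Definition ixn : 'I_n := Ordinal ixn_subproof.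

Record is_Delta (alpha : F) (Delta : {linear sl -> sl}) : Prop := IsDelta {
  Delta_E1p : forall b : sl, val b = delta_mx ix1 ixp ->
    val (Delta b) = delta_mx ixn ix1 + alpha *: delta_mx ixn ixp;
  Delta_E1n : forall b : sl, val b = delta_mx ix1 ixn ->
    val (Delta b) = delta_mx ix1 ixp;
  Delta_En1 : forall b : sl, val b = delta_mx ixn ix1 ->
    val (Delta b) = delta_mx ixn ixp;
  Delta_Enp : forall b : sl, val b = delta_mx ixn ixp ->
    val (Delta b) = delta_mx ix1 ixn;
  Delta_fix : forall b : sl, sl_basis b ->
    val b \notin [:: delta_mx ix1 ixp; delta_mx ix1 ixn;
                     delta_mx ixn ix1; delta_mx ixn ixp] ->
    Delta b = b
}.

Lemma is_Delta_unique (alpha : F) (D1 D2 : {linear sl -> sl}) :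
  is_Delta alpha D1 -> is_Delta alpha D2 -> D1 =1 D2.
Proof.
move=> H1 H2; apply: sl_basis_ind => [a x y e1 e2||b bb].
- by rewrite !linearP e1 e2.
- by rewrite !linear0.
have [|bN] := boolP (val b \in [:: delta_mx ix1 ixp; delta_mx ix1 ixn;
                     delta_mx ixn ix1; delta_mx ixn ixp]); last first.
  by rewrite (Delta_fix H1) ?(Delta_fix H2).
rewrite !inE => /or4P[] /eqP e; apply: val_inj.
- by rewrite (Delta_E1p H1) ?(Delta_E1p H2).
- by rewrite (Delta_E1n H1) ?(Delta_E1n H2).
- by rewrite (Delta_En1 H1) ?(Delta_En1 H2).
- by rewrite (Delta_Enp H1) ?(Delta_Enp H2).
Qed.

Lemma is_Delta_exists (alpha : F) :
  exists Delta : {linear sl -> sl}, is_Delta alpha Delta.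
Proof.
have n1p : ix1 != ixp by rewrite -val_eqE /= eq_sym subn_eq0 -ltnNge.
have n1n : ix1 != ixn.
  by rewrite -val_eqE /= eq_sym subn_eq0 -ltnNge (leq_trans _ n_ge3).
have npn : ixp != ixn.
  by rewrite -val_eqE /=; case: n n_ge3 => [|[|k]] // _;
     rewrite !subSS !subn0 neq_ltn ltnSn.
have np1 : ixp != ix1 by rewrite eq_sym.
have nn1 : ixn != ix1 by rewrite eq_sym.
have nnp : ixn != ixp by rewrite eq_sym.
pose f (A : 'M[F]_n) : 'M[F]_n := A
  + A ix1 ixp *:
      (delta_mx ixn ix1 + alpha *: delta_mx ixn ixp - delta_mx ix1 ixp)
  + A ix1 ixn *: (delta_mx ix1 ixp - delta_mx ix1 ixn)
  + A ixn ix1 *: (delta_mx ixn ixp - delta_mx ixn ix1)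
  + A ixn ixp *: (delta_mx ix1 ixn - delta_mx ixn ixp).
have f_lin a A B : f (a *: A + B) = a *: f A + f B.
  by apply/matrixP => i j; rewrite !mxE; ring.
have trD (i j : 'I_n) : i != j -> \tr (delta_mx i j : 'M[F]_n) = 0.
  move=> ij; rewrite /mxtrace big1 // => k _; rewrite mxE.
  by have [->|//] := eqVneq k i; rewrite (negPf ij).
have f_tr (x : sl) : f x \in traceless.
  have trN (A : 'M[F]_n) : \tr (- A) = - \tr A by exact: raddfN.
  rewrite /in_mem /= /traceless /f.
  rewrite !(mxtraceD, mxtraceZ, trN) mxtrace_sl !trD //.
  by rewrite !(mulr0, oppr0, addr0).
pose D (x : sl) : sl := Sl (f_tr x).
have D_lin : linear D by move=> a x y; apply: val_inj; rewrite /= f_lin.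
pose DL := HB.pack_for {linear sl -> sl} D
  (GRing.isLinear.Build _ _ _ _ D D_lin).
have neqs := (negPf n1p, negPf n1n, negPf npn, negPf np1, negPf nn1, negPf nnp).
exists DL; split=> b.
1-4: move=> /= e; rewrite /f e !mxE !eqxx; rewrite ?neqs /=;
  by rewrite !scale0r !addr0 scale1r addrC subrK.
move=> bb bN; apply: val_inj => /=.
suff z (i j : 'I_n) : i != j -> val b != delta_mx i j -> b i j = 0.
  move: bN; rewrite !inE !negb_or => /and4P[h1 h2 h3 h4].
  by rewrite /f !z // !scale0r !addr0.
move=> ij; case: bb => [[k [l [_ e]]]|[k [l [_ e]]] _].
  rewrite -[slval b]/(val b) e mxE.
  by have [<-|] := eqVneq i k; have [<-|] := eqVneq j l => //=; rewrite eqxx.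
rewrite -[slval b]/(val b) e !mxE.
by have [<-|_] := eqVneq i k; have [<-|_] := eqVneq i l;
   rewrite /= ?(eq_sym j) ?(negPf ij) ?subrr.
Qed.

End Delta.
End SpecialLinear.

(* Main.v *)
Require Import Defs.
From HB Require Import structures.
From mathcomp Require Import all_boot all_order all_algebra.
From mathcomp Require Import fingroup perm.

Set Implicit Arguments.
Unset Strict Implicit.
Unset Printing Implicit Defensive.

Import GRing.Theory.
Local Open Scope ring_scope.

(** Why the theorem is true. Basis elements: conjugation by an invertible
    matrix is an automorphism, and all matrix units [E_ij] with [i <> j] are
    conjugate under permutation matrices. This settles the three matrix units
    sent to matrix units. The image of [E_1,n-1] factors as

      [E_n1 + alpha E_n,n-1
         = (1 - alpha E_1,n-1) E_n1 (1 + alpha E_1,n-1)],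

    a conjugate of [E_n1] by a transvection, hence also a conjugate of
    [E_1,n-1]. The remaining basis elements are fixed.

    Failure of locality: linearity forces the non-nilpotent element
    [X = E_1n + E_n1] to go to [Y = E_1,n-1 + E_n,n-1]. On the one hand
    [Y ^ 2 = 0], so [ad Y ^ 3 = 0] ([ad_cube_eq0]). On the other hand
    [h = E_11 - E_nn] is an eigenvector of [ad X ^ 2] for the eigenvalue [4]
    ([ad_square_swap]), nonzero in characteristic zero, so [ad X] is not
    nilpotent. Automorphisms preserve the nilpotency of [ad]. *)

(** * Conjugation automorphisms *)

Lemma conj_sl_subproof (F : fieldType) (n : nat) (g : 'M[F]_n) (x : sl F n) :
  g \in unitmx -> invmx g *m x *m g \in @traceless F n.
Proof.
move=> gU.
by rewrite /in_mem /= /traceless mxtrace_mulC mulmxA mulmxV // mul1mx mxtrace_sl.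
Qed.

(** The invertibility proof is an argument of the map, because only for an
    invertible [g] is [invmx g] the inverse that keeps the trace zero. *)
Definition conj_sl (F : fieldType) (n : nat) (g : 'M[F]_n)
    (gU : g \in unitmx) (x : sl F n) : sl F n :=
  Sl (conj_sl_subproof x gU).

Lemma conj_sl_linear (F : fieldType) (n : nat) (g : 'M[F]_n)
    (gU : g \in unitmx) : linear (conj_sl gU).
Proof.
move=> a x y; apply: val_inj => /=.
by rewrite mulmxDr mulmxDl -scalemxAr -scalemxAl.
Qed.

HB.instance Definition _ (F : fieldType) (n : nat) (g : 'M[F]_n)
    (gU : g \in unitmx) :=
  GRing.isLinear.Build F (sl F n) (sl F n) _ (conj_sl gU)
    (conj_sl_linear gU).

Lemma conj_sl_automorphism (F : fieldType) (n : nat) (g : 'M[F]_n)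
    (gU : g \in unitmx) : lie_automorphism (conj_sl gU).
Proof.
have gVU : invmx g \in unitmx by rewrite unitmx_inv.
split.
  exists (conj_sl gVU) => x; apply: val_inj => /=.
    by rewrite invmxK !mulmxA mulmxV // mul1mx mulmxK.
  by rewrite invmxK !mulmxA mulVmx // mul1mx mulmxKV.
have conjM (A B : 'M[F]_n) : invmx g *m (A *m B) *m g =
    (invmx g *m A *m g) *m (invmx g *m B *m g).
  by rewrite !mulmxA mulmxK.
by move=> x y; apply: val_inj; rewrite /= mulmxBr mulmxBl !conjM.
Qed.

(** Intertwining by an invertible matrix avoids every mention of inverses when
    a concrete conjugating matrix is exhibited. *)
Lemma automorphism_of_intertwiner (F : fieldType) (n : nat) (g : 'M[F]_n)
    (x y : sl F n) :
  g \in unitmx -> val x *m g = g *m val y ->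
  exists phi : {linear sl F n -> sl F n}, lie_automorphism phi /\ y = phi x.
Proof.
move=> gU xg; exists (conj_sl gU).
split; first exact: conj_sl_automorphism.
by apply: val_inj; rewrite /= -mulmxA -[slval x]/(val x) xg mulKmx.
Qed.

Lemma exists_perm2 (T : finType) (i j k l : T) :
  i != j -> k != l -> exists s : {perm T}, s i = k /\ s j = l.
Proof.
move=> ij kl; exists (tperm i k * tperm (tperm i k j) l)%g.
rewrite !permM tpermL; split; last by rewrite tpermL.
by rewrite tpermD 1?eq_sym // -[X in X != _](tpermL i k) inj_eq //; apply: perm_inj.
Qed.

Lemma delta_mx_perm (F : fieldType) (n : nat) (s : 'S_n) (i j : 'I_n) :
  delta_mx i j *m perm_mx s = perm_mx s *m delta_mx (s i) (s j) :> 'M[F]_n.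
Proof.
rewrite -row_permE -[s in LHS]invgK -col_permE.
apply/matrixP => a b; rewrite !mxE (inj_eq perm_inj).
by rewrite -(inj_eq (@perm_inj _ s) (s^-1 b)%g) permKV.
Qed.

Lemma automorphism_delta_mx (F : fieldType) (n : nat) (i j k l : 'I_n)
    (x y : sl F n) :
  i != j -> k != l -> val x = delta_mx i j -> val y = delta_mx k l ->
  exists phi : {linear sl F n -> sl F n}, lie_automorphism phi /\ y = phi x.
Proof.
move=> ij kl xE yE; have [s [si sj]] := exists_perm2 ij kl.
apply: (automorphism_of_intertwiner (g := perm_mx s)); first exact: unitmx_perm.
by rewrite xE yE delta_mx_perm si sj.
Qed.

Lemma transvection_unitmx (F : fieldType) (n : nat) (a : F) (i j : 'I_n) :
  i != j -> 1%:M + a *: delta_mx i j \in unitmx.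
Proof.
move=> ij.
suff /mulmx1_unit[] : (1%:M + a *: delta_mx i j) *m (1%:M - a *: delta_mx i j)
  = 1%:M :> 'M[F]_n by [].
rewrite mulmxBr mulmx1 mulmxDl mul1mx -scalemxAl -scalemxAr.
by rewrite mul_delta_mx_0 1?eq_sym // !scaler0 addr0 addrK.
Qed.

(** A permutation matrix conjugates [E_ij] to [E_ki]. Then the transvection
    [t = 1 + a E_ij] finishes: since [j <> k], multiplication by [t] on the left
    fixes [E_ki + a E_kj], which is [E_ki t]. *)
Lemma automorphism_delta_mx_add (F : fieldType) (n : nat) (a : F)
    (i j k : 'I_n) (x y : sl F n) :
  i != j -> k != i -> j != k ->
  val x = delta_mx i j -> val y = delta_mx k i + a *: delta_mx k j ->
  exists phi : {linear sl F n -> sl F n}, lie_automorphism phi /\ y = phi x.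
Proof.
move=> ij ki jk xE yE; have [s [si sj]] := exists_perm2 ij ki.
apply: (@automorphism_of_intertwiner _ _
  (perm_mx s *m (1%:M + a *: delta_mx i j))).
  by rewrite unitmx_mul unitmx_perm transvection_unitmx.
rewrite xE yE mulmxA delta_mx_perm si sj -!mulmxA; congr (_ *m _).
rewrite mulmxDr mulmx1 mulmxDl mul1mx -scalemxAr mul_delta_mx.
rewrite -scalemxAl mulmxDr -scalemxAr !mul_delta_mx_0 //.
by rewrite !scaler0 !addr0 scaler0 addr0.
Qed.

(** * Nilpotency of the adjoint action *)

(** [ad Y ^ 3 z] is a combination of the products [Y ^ i z Y ^ (3 - i)], and
    one of the two exponents is always at least [2]. *)
Lemma ad_cube_eq0 (F : fieldType) (n : nat) (y z : sl F n) :
  val y *m val y = 0 -> lie y (lie y (lie y z)) = 0.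
Proof.
move=> yy; apply: val_inj => /=; move: yy => /=.
case: y z => [Y _] [Z _] /= YY.
rewrite !(mulmxBl, mulmxBr) !mulmxA YY !mul0mx -!mulmxA YY !mulmx0.
by rewrite !(subr0, sub0r, mulmx0, mul0mx, oppr0, addr0).
Qed.

(** With [X = E_ij + E_ji] and [h = E_ii - E_jj] the reason is that
    [X h = - h X] and [X ^ 2 h = h = h X ^ 2], so that
    [ad X ^ 2 h = X ^ 2 h - 2 X h X + h X ^ 2 = 4 X ^ 2 h]. *)
Lemma ad_square_swap (F : fieldType) (n : nat) (i j : 'I_n) (x h : sl F n) :
  i != j -> val x = delta_mx i j + delta_mx j i ->
  val h = delta_mx i i - delta_mx j j ->
  lie x (lie x h) = 4 *: h.
Proof.
move=> ij; case: x h => [X tX] [h th] /= XE hE; apply: val_inj => /=.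
have ji : j != i by rewrite eq_sym.
have Xh : X *m h = delta_mx j i - delta_mx i j.
  rewrite XE hE mulmxBr !mulmxDl !mul_delta_mx !mul_delta_mx_0 //.
  by rewrite add0r addr0.
have hX : h *m X = delta_mx i j - delta_mx j i.
  rewrite XE hE mulmxDr !mulmxBl !mul_delta_mx !mul_delta_mx_0 //.
  by rewrite sub0r subr0.
have XhN : h *m X = - (X *m h) by rewrite Xh hX opprB.
have XXh : X *m (X *m h) = h.
  rewrite Xh XE hE mulmxBr !mulmxDl !mul_delta_mx !mul_delta_mx_0 //.
  by rewrite add0r addr0.
have XhX : X *m h *m X = - h by rewrite -mulmxA XhN mulmxN XXh.
rewrite XhN opprK mulmxDr mulmxDl XXh XhX opprD opprK.
by rewrite addrA -!mulr2n -mulrSr -mulrSr scaler_nat.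
Qed.

(** * The counterexample *)

Theorem proposition2p6 (F : fieldType) (char0 : [pchar F] =i pred0)
    (n : nat) (n_ge3 : (3 <= n)%N) (alpha : F) (alpha_neq0 : alpha != 0)
    (Delta : {linear sl F n -> sl F n})
    (DeltaP : is_Delta n_ge3 alpha Delta) :
  (forall b : sl F n, sl_basis b ->
     exists phi : {linear sl F n -> sl F n},
       lie_automorphism phi /\ Delta b = phi b)
  /\ ~ local_automorphism Delta.
Proof.
set i1 := ix1 n_ge3; set ip := ixp n_ge3; set i_n := ixn n_ge3.
have n1p : i1 != ip by rewrite -val_eqE /= eq_sym subn_eq0 -ltnNge.
have n1n : i1 != i_n.
  by rewrite -val_eqE /= eq_sym subn_eq0 -ltnNge (leq_trans _ n_ge3).
have npn : ip != i_n.
  by rewrite -val_eqE /= neq_ltn ltn_sub2l // (leq_trans _ n_ge3).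
have np1 : ip != i1 by rewrite eq_sym.
have nn1 : i_n != i1 by rewrite eq_sym.
have nnp : i_n != ip by rewrite eq_sym.
split=> [b bB|locD].
  have [|bN] := boolP (val b \in [:: delta_mx i1 ip; delta_mx i1 i_n;
                                    delta_mx i_n i1; delta_mx i_n ip]).
    rewrite !inE => /or4P[] /eqP bE.
    - exact: (@automorphism_delta_mx_add _ _ alpha i1 ip i_n) _ _ _ _ _ bE
        (Delta_E1p DeltaP bE).
    - exact: (@automorphism_delta_mx _ _ i1 i_n i1 ip) _ _ _ _ bE (Delta_E1n DeltaP bE).
    - exact: (@automorphism_delta_mx _ _ i_n i1 i_n ip) _ _ _ _ bE
        (Delta_En1 DeltaP bE).
    - exact: (@automorphism_delta_mx _ _ i_n ip i1 i_n) _ _ _ _ bE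
        (Delta_Enp DeltaP bE).
  apply: (automorphism_of_intertwiner (g := 1%:M)); first exact: unitmx1.
  by rewrite (Delta_fix DeltaP) // mulmx1 mul1mx.
have tr_delta (i j : 'I_n) : \tr (delta_mx i j : 'M[F]_n) = (i == j)%:R.
  rewrite /mxtrace (bigD1 i) //= mxE eqxx big1 ?addr0 // => k ki.
  by rewrite mxE (negPf ki).
have tl1n : delta_mx i1 i_n \in @traceless F n.
  by rewrite /in_mem /= /traceless tr_delta (negPf n1n).
have tln1 : delta_mx i_n i1 \in @traceless F n.
  by rewrite /in_mem /= /traceless tr_delta (negPf nn1).
have tlh : delta_mx i1 i1 - delta_mx i_n i_n \in @traceless F n.
  by rewrite /in_mem /= /traceless linearB /= !tr_delta !eqxx subrr.
pose X := Sl tl1n + Sl tln1; pose h := Sl tlh.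
have DX : val (Delta X) = delta_mx i1 ip + delta_mx i_n ip.
  rewrite linearD /= -[slval (Delta (Sl tl1n))]/(val _).
  by rewrite (Delta_E1n DeltaP) // -[slval _]/(val _) (Delta_En1 DeltaP).
have DXsq : val (Delta X) *m val (Delta X) = 0.
  by rewrite DX mulmxDr !mulmxDl !mul_delta_mx_0 // !addr0.
have [phi [[phi_bij phiM] DXE]] := locD X.
have adX3 z : lie X (lie X (lie X z)) = 0.
  apply: (bij_inj phi_bij).
  by rewrite !phiM -DXE linear0; apply: ad_cube_eq0.
have adX2 : lie X (lie X h) = 4 *: h.
  exact: (@ad_square_swap _ _ i1 i_n).
have lieZ a x y : lie x (a *: y) = a *: lie x y :> sl F n.
  by apply: val_inj; rewrite /= -scalemxAr -scalemxAl scalerBr.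
have adX4 : 4 *: (4 *: h) = 0.
  by rewrite -(adX3 (lie X h)) adX2 !lieZ adX2.
have four_neq0 : 4 != 0 :> F by rewrite ((pcharf0P F).1 char0).
have /eqP h0 : h == 0.
  by move/eqP: adX4; rewrite !scaler_eq0 (negPf four_neq0).
have /eqP := congr1 (fun z : sl F n => val z i1 i1) h0.
by rewrite /= !mxE !eqxx (negPf n1n) subr0 oner_eq0.
Qed.
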